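(* Let $D$ be a directed graph on $[n]$ (loops allowed) with $m\ge 1$ arcs. Then $\mathrm{minrank}[D]=\mathrm{minrank}[D,(n+1)m]$.
   Context: For an integer $q\ge 2$ let $\langle q\rangle=\{0,1,\dots,q-1\}$. For $f=(f_1,\dots,f_n):\langle q\rangle^n\to\langle q\rangle^n$, the interaction graph $\mathrm{IG}(f)$ is the directed graph on $[n]$ with an arc $uv$ (possibly $u=v$) if and only if there exist $a,b\in\langle q\rangle^n$ that differ only in coordinate $u$ and satisfy $f_v(a)\ne f_v(b)$. $F[D,q]$ is the set of all $f:\langle q\rangle^n\to\langle q\rangle^n$ with $\mathrm{IG}(f)=D$ exactly; $\operatorname{rank}(f)=|\{f(y): y\in\langle q\rangle^n\}|$; $\mathrm{minrank}[D,q]=\min\{\operatorname{rank}(f): f\in F[D,q]\}$; and $\mathrm{minrank}[D]=\min\{\mathrm{minrank}[D,q]:q\ge 2\}$. *)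

(* Defs.v *)
From mathcomp Require Import all_boot.
From mathcomp Require Import boolp.

Set Implicit Arguments.
Unset Strict Implicit.
Unset Printing Implicit Defensive.

(* The least element of a nonempty P; the value 0 for empty P is a dummy. *)
Definition minNat (P : nat -> Prop) : nat :=
  if pselect (exists k, `[< P k >]) is left exP then ex_minn exP else 0.

Lemma minNatP (P : nat -> Prop) :
  (exists k, P k) -> P (minNat P) /\ forall k, P k -> minNat P <= k.
Proof.
move=> [k Pk]; rewrite /minNat; case: pselect => [exP|[]]; last first.
  by exists k; apply/asboolP.
case: ex_minnP => m /asboolP Pm minm; split=> // j Pj.
by apply: minm; apply/asboolP.
Qed.

Definition state (n q : nat) := {ffun 'I_n -> 'I_q}.

Definition differ_only_at (n q : nat) (u : 'I_n) (a b : state n q) : bool :=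
  [forall w, (a w != b w) == (w == u)].

(* A digraph on 'I_n, loops allowed, is its set of arcs: (u, v) is the arc
   from u to v. *)
Definition digraph (n : nat) := {set 'I_n * 'I_n}.

Definition IG (n q : nat) (f : {ffun state n q -> state n q}) : digraph n :=
  [set uv | [exists a, exists b,
     differ_only_at uv.1 a b && (f a uv.2 != f b uv.2)]].

Definition rank (n q : nat) (f : {ffun state n q -> state n q}) : nat :=
  #|[set f y | y : state n q]|.

Definition F (n : nat) (D : digraph n) (q : nat) :
    {set {ffun state n q -> state n q}} :=
  [set f | IG f == D].

Definition minrankq (n : nat) (D : digraph n) (q : nat) : nat :=
  minNat (fun k => exists2 f, f \in F D q & rank f = k).

Definition minrank (n : nat) (D : digraph n) : nat :=
  minNat (fun k => exists2 q, 2 <= q & minrankq D q = k).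

(* Every digraph is an interaction graph over every alphabet of size q >= 2:
   let f_v test whether all in-neighbours of v are nonzero. Hence both minima
   above range over nonempty sets. *)
Lemma F_nonempty (n : nat) (D : digraph n) (q : nat) :
  2 <= q -> exists f, f \in F D q.
Proof.
case: q => [|[|q]] // _.
pose one : 'I_q.+2 := Ordinal (isT : 1 < q.+2).
pose t (a : state n q.+2) (v : 'I_n) :=
  [forall u, ((u, v) \in D) ==> (a u != ord0)].
exists [ffun a : state n q.+2 => [ffun v => if t a v then one else ord0]].
rewrite inE; apply/eqP/setP => -[u v]; rewrite inE /=.
have diffE (a b : state n q.+2) :
    differ_only_at u a b -> forall w, w != u -> a w = b w.
  move=> /forallP ab w wu.
  by move: (ab w); rewrite (negPf wu) eqbF_neg negbK => /eqP.
apply/existsP/idP => [[a /existsP [b /andP [ab]]]|uvD].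
  rewrite !ffunE; apply: contraR => uvD.
  suff -> : t a v = t b v by [].
  apply: eq_forallb => w; case: (eqVneq w u) => [->|wu].
    by rewrite (negPf uvD).
  by rewrite (diffE _ _ ab).
exists [ffun => one]; apply/existsP.
exists [ffun w => if w == u then ord0 else one]; apply/andP; split.
  by apply/forallP => w; rewrite !ffunE; case: (w == u).
rewrite !ffunE.
have -> : t [ffun => one] v by apply/forallP => w; rewrite ffunE implybT.
rewrite ifN //; apply/forallPn; exists u.
by rewrite uvD ffunE eqxx.
Qed.

Lemma minrankqP (n : nat) (D : digraph n) (q : nat) : 2 <= q ->
  (exists2 f, f \in F D q & rank f = minrankq D q) /\
  (forall f, f \in F D q -> minrankq D q <= rank f).
Proof.
move=> q2; have [f fD] := F_nonempty D q2.
have [|H1 H2] := @minNatP (fun k => exists2 f, f \in F D q & rank f = k).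
  by exists (rank f), f.
by split=> // g gD; apply: H2; exists g.
Qed.

Lemma minrankP (n : nat) (D : digraph n) :
  (exists2 q, 2 <= q & minrankq D q = minrank D) /\
  (forall q, 2 <= q -> minrank D <= minrankq D q).
Proof.
have [|H1 H2] := @minNatP (fun k => exists2 q, 2 <= q & minrankq D q = k).
  by exists (minrankq D 2), 2.
by split=> // q q2; apply: H2; exists q.
Qed.

(* Main.v *)
Require Import Defs.
From mathcomp Require Import all_boot.

(** Fix [f] with interaction graph [D] and, for every arc [uv], a pair of states
    witnessing it.  For each coordinate, at most [2m] symbols occur among the
    witnesses, and at most [2m] among the values [f_v] takes on the witnesses of
    the arcs [uv].  So if [q' >= 2m], composing [f] on both sides with coordinatewise
    maps between the alphabets that are mutually inverse on these symbols gives
    a map over an alphabet of size [q'] with the same interaction graph and no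
    larger rank.  Finally [2m <= (n + 1)m]. *)

(** [h] sends the element at position i of [enum A] to the one at position i of [enum S], and [g]
    goes back; what they do elsewhere is irrelevant. *)
Lemma exists_cancel_in (T S : finType) (x0 : T) (y0 : S) (A : {set T}) :
  #|A| <= #|S| -> exists h : T -> S, exists g : S -> T, {in A, cancel h g}.
Proof.
move=> leAS.
exists (fun x => nth y0 (enum S) (index x (enum A))).
exists (fun y => nth x0 (enum A) (index y (enum S))) => x xA.
have ltx : index x (enum A) < #|A| by rewrite cardE index_mem mem_enum.
rewrite index_uniq ?enum_uniq ?nth_index ?mem_enum //.
by rewrite -cardE (leq_trans ltx).
Qed.

Lemma card_image_pair (I T : finType) (D : {set I}) (f g : I -> T) :
  #|[set f i | i in D] :|: [set g i | i in D]| <= 2 * #|D|.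
Proof.
rewrite mul2n -addnn (leq_trans (leq_card_setU _ _).1) //.
by rewrite leq_add ?leq_imset_card.
Qed.

Lemma differ_only_atP (n q : nat) (u : 'I_n) (a b : state n q) :
  reflect (a u <> b u /\ forall w, w != u -> a w = b w) (differ_only_at u a b).
Proof.
apply: (iffP forallP) => [ab | [abu abw] w].
  split=> [|w wu]; first by apply/eqP; rewrite (eqP (ab u)).
  by apply/eqP; rewrite -[_ == _]negbK (eqP (ab w)).
by have [->|/abw->] := eqVneq w u; rewrite ?eqxx //; apply/eqP/eqP.
Qed.

Lemma IG_witness (n q : nat) (f : {ffun state n q -> state n q}) : 0 < q ->
  exists a b : 'I_n * 'I_n -> state n q, forall e, e \in IG f ->
    differ_only_at e.1 (a e) (b e) /\ f (a e) e.2 != f (b e) e.2.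
Proof.
move=> q_gt0; pose z : state n q := [ffun=> Ordinal q_gt0].
have [p pP] : exists p : 'I_n * 'I_n -> state n q * state n q,
    forall e, e \in IG f ->
      differ_only_at e.1 (p e).1 (p e).2 /\ f (p e).1 e.2 != f (p e).2 e.2.
  apply: (@fin_all_exists _ _ (fun e r => e \in IG f ->
    differ_only_at e.1 r.1 r.2 /\ f r.1 e.2 != f r.2 e.2)) => e.
  (* Pairs that are not arcs get the dummy [(z, z)], so that the choice is total. *)
  have [|_] := boolP (e \in IG f); last by exists (z, z).
  by rewrite inE => /existsP[a /existsP[b /andP[? ?]]]; exists (a, b).
by exists (fun e => (p e).1), (fun e => (p e).2).
Qed.

(** [g] decodes the input and [h] encodes the output. They need not be inverse to each other: inputs
    and outputs will use separate codes. *)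
Definition conj_alphabet (n q q' : nat) (h : 'I_n -> 'I_q -> 'I_q')
    (g : 'I_n -> 'I_q' -> 'I_q) (f : {ffun state n q -> state n q}) :
    {ffun state n q' -> state n q'} :=
  [ffun x : state n q' => [ffun v => h v (f [ffun w => g w (x w)] v)]].

Lemma rank_conj_alphabet (n q q' : nat) (h : 'I_n -> 'I_q -> 'I_q')
    (g : 'I_n -> 'I_q' -> 'I_q) (f : {ffun state n q -> state n q}) :
  rank (conj_alphabet n q q' h g f) <= rank f.
Proof.
pose H (s : state n q) : state n q' := [ffun v => h v (s v)].
apply: leq_trans (leq_imset_card H _); apply/subset_leq_card/subsetP.
move=> _ /imsetP[x _ ->]; rewrite ffunE.
by apply: (imset_f H); apply: imset_f.
Qed.

(** Coordinatewise recoding, however lossy, creates no dependency: decoded states still agree off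
    [u]. *)
Lemma IG_conj_alphabet_sub (n q q' : nat) (h : 'I_n -> 'I_q -> 'I_q')
    (g : 'I_n -> 'I_q' -> 'I_q) (f : {ffun state n q -> state n q}) :
  IG (conj_alphabet n q q' h g f) \subset IG f.
Proof.
apply/subsetP => -[u v]; rewrite !inE /=.
move=> /existsP[a /existsP[b /andP[/differ_only_atP[_ abw]]]].
rewrite !ffunE; set ga := finfun _; set gb := finfun _ => neq.
apply/existsP; exists ga; apply/existsP; exists gb.
have {}neq : f ga v != f gb v by apply: contra_neq neq => ->.
rewrite neq andbT; apply/differ_only_atP.
have gabw w : w != u -> ga w = gb w by move=> /abw; rewrite !ffunE => ->.
(* Agreement at [u] too would make the decoded states equal, against [neq]. *)
split=> // gabu; case/eqP: neq; congr (f _ v); apply/ffunP => w.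
by have [->|/gabw] := eqVneq w u.
Qed.

(** Despite the name, [q'] may exceed [q]; only the number of arcs bounds it from below. *)
Lemma shrink_alphabet (n q q' : nat) (f : {ffun state n q -> state n q}) :
    0 < q -> 0 < q' -> 2 * #|IG f| <= q' ->
  exists2 f' : {ffun state n q' -> state n q'},
    f' \in F (IG f) q' & rank f' <= rank f.
Proof.
move=> q_gt0 q'_gt0 leq'; have [a [b abP]] := IG_witness n q f q_gt0.
pose x0 := Ordinal q_gt0; pose y0 := Ordinal q'_gt0.
have cancel_on (A B : 'I_n -> 'I_n * 'I_n -> 'I_q) :
    exists h : 'I_n -> 'I_q -> 'I_q', exists g : 'I_n -> 'I_q' -> 'I_q,
      forall w e, e \in IG f ->
        g w (h w (A w e)) = A w e /\ g w (h w (B w e)) = B w e.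
  have /fin_all_exists[h /fin_all_exists[g gh]] w :
      exists h : 'I_q -> 'I_q', exists g : 'I_q' -> 'I_q,
        {in [set A w e | e in IG f] :|: [set B w e | e in IG f], cancel h g}.
    apply: exists_cancel_in x0 y0 _ _; rewrite card_ord.
    exact: leq_trans (card_image_pair _ _ _ _ _) leq'.
  exists h, g => w e eD.
  by split; apply: gh; rewrite inE imset_f ?orbT.
(* One code for the symbols in the witnesses, then one for the values of [f] on them. *)
have [h [g ghK]] := cancel_on (fun w e => a e w) (fun w e => b e w).
have [k [l klK]] := cancel_on (fun v e => f (a e) v) (fun v e => f (b e) v).
exists (conj_alphabet n q q' k g f); last exact: rank_conj_alphabet.
rewrite inE eqEsubset IG_conj_alphabet_sub; apply/subsetP => e eD.
have [/differ_only_atP[abu abw] neq] := abP e eD.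
pose a' : state n q' := [ffun w => h w (a e w)].
pose b' : state n q' := [ffun w => h w (b e w)].
have ga' : [ffun w => g w (a' w)] = a e.
  by apply/ffunP => w; rewrite !ffunE; have [] := ghK w e eD.
have gb' : [ffun w => g w (b' w)] = b e.
  by apply/ffunP => w; rewrite !ffunE; have [] := ghK w e eD.
rewrite inE; apply/existsP; exists a'; apply/existsP; exists b'.
apply/andP; split.
  apply/differ_only_atP; split=> [|w /abw]; last by rewrite !ffunE => ->.
  (* The left inverse [g] makes [h] injective on the two symbols; [l] does the same for [k]
     below. *)
  by rewrite !ffunE => ab'; apply: abu; have [<- <-] := ghK e.1 e eD; rewrite ab'.
rewrite !ffunE ga' gb'; apply: contra_neq neq => eqk.
by have [<- <-] := klK e.2 e eD; rewrite eqk.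
Qed.

Theorem theorem3p3 (n : nat) (D : digraph n) (m : nat) :
  #|D| = m -> 1 <= m -> minrank D = minrankq D ((n + 1) * m).
Proof.
move=> Dm m_gt0.
(* An arc has an endpoint, so n + 1 is at least 2. *)
have n_gt0 : 0 < n.
  by move: m_gt0; rewrite -Dm => /card_gt0P[[u _] _]; apply: leq_trans (ltn_ord u).
have le2m : 2 * m <= (n + 1) * m by rewrite leq_mul2r addn1 ltnS n_gt0 orbT.
have Q_gt1 : 2 <= (n + 1) * m by apply: leq_trans le2m; rewrite leq_pmulr.
have [[q q_gt1 minD] min_le] := minrankP D.
have [[f fD rankf] _] := minrankqP D q_gt1.
have [_ min_rank] := minrankqP D Q_gt1.
have IGf : IG f = D by apply/eqP; move: fD; rewrite inE.
have [|f' f'D lef'] := shrink_alphabet n q ((n + 1) * m) f (ltnW q_gt1) (ltnW Q_gt1).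
  by rewrite IGf Dm.
(* The other inequality comes from recoding [f], which attains the overall minimum. *)
apply/eqP; rewrite eqn_leq min_le //= -minD -rankf.
by apply: leq_trans lef'; apply: min_rank; rewrite -IGf.
Qed.
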